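(* If the nonuniform mesh $\mathcal{D}_h$ is the image of a uniform mesh on $\mathcal{D}$ via a smooth mapping, then the nonuniform finite difference formulas $$\frac{\partial^2u}{\partial x^2}\Big|_{(x_i,y_j,t)}\approx\frac{2u_{i-1,j}(t)}{h_{x,i-1}(h_{x,i-1}+h_{x,i})}-\frac{2u_{i,j}(t)}{h_{x,i-1}h_{x,i}}+\frac{2u_{i+1,j}(t)}{h_{x,i}(h_{x,i-1}+h_{x,i})}$$ and $$\frac{\partial^2u}{\partial y^2}\Big|_{(x_i,y_j,t)}\approx\frac{2u_{i,j-1}(t)}{h_{y,j-1}(h_{y,j-1}+h_{y,j})}-\frac{2u_{i,j}(t)}{h_{y,j-1}h_{y,j}}+\frac{2u_{i,j+1}(t)}{h_{y,j}(h_{y,j-1}+h_{y,j})},$$ used at the interior mesh points $(x_i,y_j)$, $1\le i\le N_x$, $1\le j\le N_y$, are in fact second-order.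
   Context: $\mathcal{D}=(-1,1)\times(-1,1)$. For fixed $N_x,N_y\gg1$, $\mathcal{D}_h=\{(x_i,y_j):0\le i\le N_x+1,\ 0\le j\le N_y+1\}$, where $x_0=y_0=-1$, $x_{N_x+1}=y_{N_y+1}=1$, $h_{x,i}=x_{i+1}-x_i>0$ for $0\le i\le N_x$ and $h_{y,j}=y_{j+1}-y_j>0$ for $0\le j\le N_y$. The function $u(x,y,t)$ is the solution of $u_t=\frac{1}{a^2\sigma}u_{xx}+\frac{1}{b^2\sigma}u_{yy}+g(\varepsilon,u)$ for $(x,y)\in\mathcal{D}$, $t_0<t<T_q<\infty$, with $u=0$ on $\partial\mathcal{D}$ and $u(x,y,t_0)=u_0(x,y)$. Here $a,b>0$. The degeneracy function $\sigma(x,y)\ge0$ on $\overline{\mathcal{D}}$ vanishes only on a subset of $\partial\mathcal{D}$. The reaction term $g(\varepsilon,u)=f(\varepsilon,u)/\sigma(x,y)$ is nonlinear, with a bounded stochastic influence $\varepsilon(x,y)$. $u_{i,j}(t)$ denotes the value (or approximation) of $u$ at $(x_i,y_j,t)$. That the mesh is the image of a uniform mesh via a smooth mapping means that $x_i=g^{(x)}(\omega^{(x)}_i)$ and $y_j=g^{(y)}(\omega^{(y)}_j)$ with smooth $g^{(x)},g^{(y)}$ and uniformly spaced $\omega^{(x)}_i=-1+ik_1$, $\omega^{(y)}_j=-1+jk_2$, $k_1=2/(N_x+1)$, $k_2=2/(N_y+1)$. On general nonuniform meshes the two formulas are only first-order approximations.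
   Formalization: The solution u is additionally assumed to have continuous pure x- and y-derivatives up to order four, extending to the closed square (without such smoothness the claim fails); the second-order error bound is uniform for t in compact subintervals of (t_0,T_q). *)

(* Defs.v *)
From Stdlib Require Import Reals List.
From Coquelicot Require Import Coquelicot.
Open Scope R_scope.

Definition open_square (x y : R) : Prop := -1 < x < 1 /\ -1 < y < 1.
Definition closed_square (x y : R) : Prop := -1 <= x <= 1 /\ -1 <= y <= 1.
Definition square_boundary (x y : R) : Prop :=
  closed_square x y /\ ~ open_square x y.

(* Joint continuity in (x, y, t) on a subset of R^3. *)
Definition continuous3_on (A : R -> R -> R -> Prop) (v : R -> R -> R -> R) : Prop :=
  continuous_on (fun p : R * R * R => A (fst (fst p)) (snd (fst p)) (snd p))
                (fun p : R * R * R => v (fst (fst p)) (snd (fst p)) (snd p)).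

(* Classical solutions of
     u_t = u_xx / (a^2 sigma) + u_yy / (b^2 sigma) + f(eps, u) / sigma.
   [eps] is one realization of the bounded stochastic influence. *)
Record is_solution (a b t0 Tq : R) (sigma eps : R -> R -> R) (f : R -> R -> R)
    (u0 : R -> R -> R) (u : R -> R -> R -> R) : Prop := {
  sol_a : 0 < a;
  sol_b : 0 < b;
  sol_time : t0 < Tq;
  sol_sigma_ge0 : forall x y, closed_square x y -> 0 <= sigma x y;
  sol_sigma_eq0 : forall x y,
    closed_square x y -> sigma x y = 0 -> square_boundary x y;
  sol_eps : exists K, forall x y, closed_square x y -> Rabs (eps x y) <= K;
  sol_cont :
    continuous3_on (fun x y t => closed_square x y /\ t0 <= t < Tq) u;
  sol_diff : forall x y t, open_square x y -> t0 < t < Tq ->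
    ex_derive (fun s => u x y s) t /\
    (forall k, (k <= 2)%nat ->
       ex_derive_n (fun z => u z y t) k x /\ ex_derive_n (fun z => u x z t) k y);
  sol_pde : forall x y t, open_square x y -> t0 < t < Tq ->
    Derive (fun s => u x y s) t =
      / (a ^ 2 * sigma x y) * Derive_n (fun z => u z y t) 2 x
      + / (b ^ 2 * sigma x y) * Derive_n (fun z => u x z t) 2 y
      + f (eps x y) (u x y t) / sigma x y;
  sol_bdry : forall x y t, square_boundary x y -> t0 < t < Tq -> u x y t = 0;
  sol_init : forall x y, closed_square x y -> u x y t0 = u0 x y
}.

(* The pure spatial derivatives up to order n exist in the open square and
   extend continuously to the closed one, for t in the open interval (t0, Tq).
   Nothing is required as t tends to Tq. *)
Definition space_Cn (n : nat) (t0 Tq : R) (u : R -> R -> R -> R) : Prop :=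
  forall k, (k <= n)%nat ->
    (forall x y t, open_square x y -> t0 < t < Tq ->
       ex_derive_n (fun z => u z y t) k x /\ ex_derive_n (fun z => u x z t) k y) /\
    (exists v : R -> R -> R -> R,
       continuous3_on (fun x y t => closed_square x y /\ t0 < t < Tq) v /\
       forall x y t, open_square x y -> t0 < t < Tq ->
         v x y t = Derive_n (fun z => u z y t) k x) /\
    (exists w : R -> R -> R -> R,
       continuous3_on (fun x y t => closed_square x y /\ t0 < t < Tq) w /\
       forall x y t, open_square x y -> t0 < t < Tq ->
         w x y t = Derive_n (fun z => u x z t) k y).

(* C^infinity on [-1, 1], in the same sense. *)
Definition smooth_mapping (g : R -> R) : Prop :=
  continuous_on (fun s : R => -1 <= s <= 1) g /\
  forall k : nat,
    (forall s, -1 < s < 1 -> ex_derive_n g k s) /\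
    (exists v : R -> R,
       continuous_on (fun s : R => -1 <= s <= 1) v /\
       forall s, -1 < s < 1 -> v s = Derive_n g k s).

(* A one-dimensional mesh x_0 < ... < x_{N+1}; the values of the sequence
   beyond N+1 are irrelevant. *)
Definition step (x : nat -> R) (i : nat) : R := x (S i) - x i.

Definition is_mesh (N : nat) (x : nat -> R) : Prop :=
  x 0%nat = -1 /\ x (S N) = 1 /\ forall i, (i <= N)%nat -> 0 < step x i.

Definition uniform_node (N i : nat) : R := -1 + INR i * (2 / INR (S N)).

Definition image_of_uniform (g : R -> R) (N : nat) (x : nat -> R) : Prop :=
  forall i, (i <= S N)%nat -> x i = g (uniform_node N i).

Definition mesh_width (N : nat) (x : nat -> R) : R :=
  fold_right Rmax 0 (map (step x) (seq 0 (S N))).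

(* Meaningful for 1 <= i only, since i - 1 is truncated. *)
Definition fd2 (x v : nat -> R) (i : nat) : R :=
  2 * v (i - 1)%nat / (step x (i - 1) * (step x (i - 1) + step x i))
  - 2 * v i / (step x (i - 1) * step x i)
  + 2 * v (S i) / (step x i * (step x (i - 1) + step x i)).

(* Main.v *)
Require Import Defs.
From Stdlib Require Import Reals Factorial List Lra Lia ClassicalEpsilon.
From Coquelicot Require Import Coquelicot.
Open Scope R_scope.

(** Let [h1] and [h2] be the steps to the left and to the right of a node [p].
Expanding [f (p - h1)] and [f (p + h2)] to third order, the three-point
formula returns

    D2 + D3 (h2 - h1) / 3 + O(h^2),

where [D2] and [D3] are the second and third derivatives of [f] at [p] and [h]
bounds [h1] and [h2] ([fd2_error]).  On a general mesh the middle term is only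
first order.  When the mesh is the image of a uniform one of step [k] under a
smooth map [g], however, [h2 - h1] is the second difference
[g (w + k) - 2 g w + g (w - k)], hence at most [k^2] times a bound of the second
derivative of [g].  Moreover the [N + 1] steps of the mesh add up to the length
2 of the interval, so the largest is at least their average,
[k = 2 / (N + 1)].  The middle term is therefore of the order of the square of
the mesh width too ([adjacent_step_difference]), and both terms combine in
[fd2_second_order].

Two points make the constant independent of the mesh and of the node.  The
bounds of the second derivative of [g] and of the third and fourth spatial
derivatives of [u] are uniform because these derivatives extend continuously
to compact sets, namely [-1, 1] and the closed square times [t1, t2].  The
stencil of a node next to the boundary reaches the boundary itself, where [g]
and [u] are only known to be continuous: [taylor_bound] extends the Taylor
estimate to the endpoints by passing to the limit in both sides. *)

(** * Uniform bounds by compactness *)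

(** Finitely many of the neighbourhoods on which [f] is bounded cover the box,
and the largest of their bounds serves for all of it. *)
Lemma bounded_of_locally_bounded (n : nat) (a b : Compactness.Tn n R)
    (f : Compactness.Tn n R -> R) :
  (forall t, bounded_n n a b t -> exists (d : posreal) (M : R),
     forall x, bounded_n n a b x -> close_n n d x t -> Rabs (f x) <= M) ->
  exists M, forall x, bounded_n n a b x -> Rabs (f x) <= M.
Proof.
intros Hloc.
assert (Hch : forall t, { dM : posreal * R | bounded_n n a b t ->
    forall x, bounded_n n a b x -> close_n n (fst dM) x t ->
    Rabs (f x) <= snd dM }).
{ intros t; apply constructive_indefinite_description.
  destruct (classic (bounded_n n a b t)) as [Ht | Ht].
  - destruct (Hloc t Ht) as [d [M H]]; exists (d, M); intros _; exact H.
  - exists (mkposreal 1 Rlt_0_1, 0); contradiction. }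
apply NNPP; intros Hno.
apply (compactness_list n a b (fun t => fst (proj1_sig (Hch t)))).
intros [l Hl]; apply Hno.
exists (fold_right Rmax 0 (map (fun t => snd (proj1_sig (Hch t))) l)).
intros x Hx; destruct (Hl x Hx) as [t [Hin [Ht Hc]]].
apply Rle_trans with (snd (proj1_sig (Hch t))).
- exact (proj2_sig (Hch t) Ht x Hx Hc).
- clear - Hin; induction l as [|s l IH]; simpl in *; [contradiction|].
  destruct Hin as [<- | Hin]; [apply Rmax_l|].
  eapply Rle_trans; [exact (IH Hin) | apply Rmax_r].
Qed.

Lemma continuous_on_segment_bounded (lo hi : R) (v : R -> R) :
  continuous_on (fun s : R => lo <= s <= hi) v ->
  exists M, forall s, lo <= s <= hi -> Rabs (v s) <= M.
Proof.
intros Hv.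
destruct (bounded_of_locally_bounded 1 (lo, tt) (hi, tt) (fun p => v (fst p)))
  as [M HM].
- intros [t []] [Ht _].
  destruct (Hv t Ht _ (locally_ball (v t) (mkposreal 1 Rlt_0_1))) as [d Hd].
  exists d, (Rabs (v t) + 1); intros [x []] [Hx _] [Hc _]; simpl.
  assert (H : Rabs (v x - v t) < 1) by exact (Hd x Hc Hx).
  pose proof (Rabs_triang_inv (v x) (v t)); lra.
- exists M; intros s Hs; exact (HM (s, tt) (conj Hs I)).
Qed.

Lemma continuous3_on_box_bounded (A : R -> R -> R -> Prop) (t1 t2 : R)
    (v : R -> R -> R -> R) :
  continuous3_on A v ->
  (forall x y t, closed_square x y -> t1 <= t <= t2 -> A x y t) ->
  exists M, forall x y t, closed_square x y -> t1 <= t <= t2 ->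
    Rabs (v x y t) <= M.
Proof.
intros Hv HA.
destruct (bounded_of_locally_bounded 3 (-1, (-1, (t1, tt))) (1, (1, (t2, tt)))
  (fun p => v (fst p) (fst (snd p)) (fst (snd (snd p))))) as [M HM].
- intros [x [y [t []]]] [Hx [Hy [Ht _]]].
  destruct (Hv (x, y, t) (HA x y t (conj Hx Hy) Ht) _
    (locally_ball (v x y t) (mkposreal 1 Rlt_0_1))) as [d Hd].
  exists d, (Rabs (v x y t) + 1).
  intros [x' [y' [t' []]]] [Hx' [Hy' [Ht' _]]] [Cx [Cy [Ct _]]]; simpl.
  assert (H : Rabs (v x' y' t' - v x y t) < 1)
    by exact (Hd (x', y', t') (conj (conj Cx Cy) Ct)
                (HA x' y' t' (conj Hx' Hy') Ht')).
  pose proof (Rabs_triang_inv (v x' y' t') (v x y t)); lra.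
- exists M; intros x y t [Hx Hy] Ht.
  exact (HM (x, (y, (t, tt))) (conj Hx (conj Hy (conj Ht I)))).
Qed.

Lemma continuous3_on_slice_x (A : R -> R -> R -> Prop) (v : R -> R -> R -> R)
    (y t : R) :
  continuous3_on A v -> continuous_on (fun z => A z y t) (fun z => v z y t).
Proof.
intros Hv z Hz P HP.
destruct (Hv (z, y, t) Hz P HP) as [d Hd].
exists d; intros z' Hz' HA.
exact (Hd (z', y, t) (conj (conj Hz' (ball_center y d)) (ball_center t d)) HA).
Qed.

Lemma continuous3_on_slice_y (A : R -> R -> R -> Prop) (v : R -> R -> R -> R)
    (x t : R) :
  continuous3_on A v -> continuous_on (fun z => A x z t) (fun z => v x z t).
Proof.
intros Hv z Hz P HP.
destruct (Hv (x, z, t) Hz P HP) as [d Hd].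
exists d; intros z' Hz' HA.
exact (Hd (x, z', t) (conj (conj (ball_center x d) Hz') (ball_center t d)) HA).
Qed.

Lemma continuous_on_sub (D E : R -> Prop) (f : R -> R) :
  (forall z, E z -> D z) -> continuous_on D f -> continuous_on E f.
Proof.
intros HED Hf z Hz P HP.
destruct (Hf z (HED z Hz) P HP) as [d Hd].
exists d; intros z' Hz' HE; exact (Hd z' Hz' (HED z' HE)).
Qed.

(** * Taylor's inequality up to the endpoints *)

(** Each point of the closed interval is a limit of points of the open one, and
a weak inequality passes to the limit. *)
Lemma le_on_closure (lo hi : R) (f phi : R -> R) :
  lo < hi -> continuous_on (fun z => lo <= z <= hi) f ->
  (forall z, continuous phi z) ->
  (forall z, lo < z < hi -> f z <= phi z) ->
  forall q, lo <= q <= hi -> f q <= phi q.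
Proof.
intros Hlh Hf Hphi Hle q Hq.
apply Rnot_lt_le; intros Hlt.
assert (He : 0 < (f q - phi q) / 2) by lra.
destruct (Hf q Hq _ (locally_ball (f q) (mkposreal _ He))) as [d1 H1].
destruct (Hphi q _ (locally_ball (phi q) (mkposreal _ He))) as [d2 H2].
pose proof (cond_pos d1) as Hd1; pose proof (cond_pos d2) as Hd2.
set (d := Rmin d1 d2).
assert (Hd : 0 < d) by (apply Rmin_pos; assumption).
assert (Hdd1 : d <= d1) by apply Rmin_l.
assert (Hdd2 : d <= d2) by apply Rmin_r.
(* Moving from q towards the midpoint by a fraction s enters the open interval. *)
set (s := Rmin 1 (d / (hi - lo))).
assert (Hs0 : 0 < s) by (apply Rmin_pos; [lra | apply Rdiv_lt_0_compat; lra]).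
assert (Hs1 : s <= 1) by apply Rmin_l.
assert (Hsd : s * (hi - lo) <= d).
{ apply Rle_trans with (d / (hi - lo) * (hi - lo)).
  - apply Rmult_le_compat_r; [lra | apply Rmin_r].
  - right; field; lra. }
set (z := q + s * ((lo + hi) / 2 - q)).
assert (Hz : lo < z < hi) by (unfold z; split; nra).
assert (Hzq : Rabs (z - q) < d) by (unfold z; apply Rabs_def1; nra).
assert (A1 : Rabs (f z - f q) < (f q - phi q) / 2)
  by (apply (H1 z); [apply Rlt_le_trans with d; assumption | lra]).
assert (A2 : Rabs (phi z - phi q) < (f q - phi q) / 2)
  by (apply (H2 z); apply Rlt_le_trans with d; assumption).
apply Rabs_def2 in A1; apply Rabs_def2 in A2.
pose proof (Hle z Hz); lra.
Qed.

Definition taylor_poly (f : R -> R) (p : R) (n : nat) (q : R) : R :=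
  sum_f_R0 (fun m => (q - p) ^ m / INR (fact m) * Derive_n f m p) n.

(** Lagrange's form of the remainder of order [n], with the derivative of order
[n + 1] replaced by its bound [M]. *)
Definition taylor_err (M p : R) (n : nat) (q : R) : R :=
  M * Rabs (q - p) ^ S n / INR (fact (S n)).

Lemma continuous_taylor_poly (f : R -> R) (p : R) (n : nat) (q : R) :
  continuous (taylor_poly f p n) q.
Proof.
unfold taylor_poly; induction n as [|n IH]; simpl sum_f_R0.
- apply (ex_derive_continuous (K := R_AbsRing) (V := R_NormedModule)); auto_derive; exact I.
- apply (continuous_plus (fun q => sum_f_R0 _ n)); [exact IH|].
  apply (ex_derive_continuous (K := R_AbsRing) (V := R_NormedModule)); auto_derive; exact I.
Qed.

Lemma continuous_taylor_err (M p : R) (n : nat) (q : R) :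
  continuous (taylor_err M p n) q.
Proof.
unfold taylor_err.
apply (continuous_comp (fun q => Rabs (q - p))
  (fun r => M * r ^ S n / INR (fact (S n)))).
- apply (continuous_comp (fun q => q - p) Rabs); [|apply continuous_Rabs].
  apply (ex_derive_continuous (K := R_AbsRing) (V := R_NormedModule)); auto_derive; exact I.
- apply (ex_derive_continuous (K := R_AbsRing) (V := R_NormedModule)); auto_derive; exact I.
Qed.

Lemma taylor_poly_center (f : R -> R) (p : R) (n : nat) :
  taylor_poly f p n p = f p.
Proof.
unfold taylor_poly; induction n as [|n IH]; cbn [sum_f_R0].
- simpl; field.
- rewrite IH, Rminus_diag, pow_i by lia; unfold Rdiv; ring.
Qed.

Lemma taylor_bound_right (lo hi M : R) (n : nat) (f : R -> R) (p q : R) :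
  (forall z, lo < z < hi -> forall k, (k <= S n)%nat -> ex_derive_n f k z) ->
  (forall z, lo < z < hi -> Rabs (Derive_n f (S n) z) <= M) ->
  lo < p -> p < q -> q < hi ->
  Rabs (f q - taylor_poly f p n q) <= taylor_err M p n q.
Proof.
intros Hex HM Hp Hpq Hq.
destruct (Taylor_Lagrange f n p q Hpq) as [z [Hz ->]].
{ intros z Hz; apply Hex; lra. }
unfold taylor_poly, taylor_err.
match goal with |- Rabs (?S + ?r - ?S) <= _ => replace (S + r - S) with r by ring end.
rewrite Rabs_mult; unfold Rdiv; rewrite Rabs_mult, <- RPow_abs.
rewrite (Rabs_pos_eq (/ _)) by (left; apply Rinv_0_lt_compat, INR_fact_lt_0).
rewrite (Rmult_comm M), Rmult_assoc, (Rmult_assoc _ M), (Rmult_comm M).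
rewrite <- !Rmult_assoc.
apply Rmult_le_compat_l; [|apply HM; lra].
apply Rmult_le_pos; [apply pow_le, Rabs_pos|].
left; apply Rinv_0_lt_compat, INR_fact_lt_0.
Qed.

(** Lagrange's formula expands to the right of [p]; the points to the left are
reached through the reflection [y |-> - y]. *)
Lemma taylor_bound_open (lo hi M : R) (n : nat) (f : R -> R) (p q : R) :
  (forall z, lo < z < hi -> forall k, (k <= S n)%nat -> ex_derive_n f k z) ->
  (forall z, lo < z < hi -> Rabs (Derive_n f (S n) z) <= M) ->
  lo < p < hi -> lo < q < hi ->
  Rabs (f q - taylor_poly f p n q) <= taylor_err M p n q.
Proof.
intros Hex HM Hp Hq.
destruct (Rtotal_order p q) as [Hpq | [Hpq | Hpq]].
- apply taylor_bound_right with lo hi; tauto.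
- subst q; rewrite taylor_poly_center; unfold taylor_err.
  rewrite !Rminus_diag, Rabs_R0, pow_i by lia; unfold Rdiv; right; ring.
- assert (Hloc : forall z, - hi < z < - lo -> locally (- z) (fun y : R =>
      forall k, (k <= S n)%nat -> ex_derive_n f k y)).
  { intros z Hz.
    apply (filter_imp (fun y : R => lo < y < hi)); [exact Hex|].
    apply (open_and _ _ (open_gt lo) (open_lt hi)); lra. }
  assert (Hloc' : forall k z, (k <= S n)%nat -> - hi < z < - lo ->
      locally (- z) (fun y : R => forall j, (j <= k)%nat -> ex_derive_n f j y)).
  { intros k z Hk Hz; generalize (Hloc z Hz); apply filter_imp.
    intros y Hy j Hj; apply Hy; lia. }
  pose proof (taylor_bound_right (- hi) (- lo) M n (fun y => f (- y)) (- p) (- q))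
    as H.
  replace (taylor_poly f p n q)
    with (taylor_poly (fun y => f (- y)) (- p) n (- q)).
  + replace (taylor_err M p n q) with (taylor_err M (- p) n (- q)).
    * cbv beta in H; rewrite Ropp_involutive in H.
      apply H; try lra.
      -- intros z Hz k Hk; apply ex_derive_n_comp_opp; auto.
      -- intros z Hz; rewrite Derive_n_comp_opp by auto.
         rewrite Rabs_mult, pow_1_abs, Rmult_1_l; apply HM; lra.
    * unfold taylor_err; do 3 f_equal.
      rewrite <- Rabs_Ropp; f_equal; ring.
  (* The sign [(-1)^m] arises once from the power and once from the derivative
     of the reflected function, and cancels. *)
  + unfold taylor_poly; apply sum_eq; intros m Hm.
    rewrite Derive_n_comp_opp by (apply Hloc'; [lia | lra]).
    rewrite Ropp_involutive.
    replace (- q - - p) with (-1 * (q - p)) by ring.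
    rewrite Rpow_mult_distr.
    assert (H1 : (-1) ^ m * (-1) ^ m = 1).
    { rewrite <- Rpow_mult_distr; replace (-1 * -1) with 1 by ring; apply pow1. }
    transitivity ((-1) ^ m * (-1) ^ m
      * ((q - p) ^ m / INR (fact m) * Derive_n f m p)).
    * field; apply INR_fact_neq_0.
    * rewrite H1; ring.
Qed.

(** At [q = lo] or [q = hi] there need not be any derivative, but both sides are
continuous in [q], so the estimate in the open interval passes to the limit. *)
Lemma taylor_bound (lo hi M : R) (n : nat) (f : R -> R) (p q : R) :
  continuous_on (fun z => lo <= z <= hi) f ->
  (forall z, lo < z < hi -> forall k, (k <= S n)%nat -> ex_derive_n f k z) ->
  (forall z, lo < z < hi -> Rabs (Derive_n f (S n) z) <= M) ->
  lo < p < hi -> lo <= q <= hi ->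
  Rabs (f q - taylor_poly f p n q) <= taylor_err M p n q.
Proof.
intros Hf Hex HM Hp Hq.
pose proof (fun z => taylor_bound_open lo hi M n f p z Hex HM Hp) as H.
apply Rabs_le; split.
- enough (- f q <= taylor_err M p n q - taylor_poly f p n q) by lra.
  apply (le_on_closure lo hi (fun z => - f z)
    (fun z => taylor_err M p n z - taylor_poly f p n z)); try lra.
  + intros z Hz; eapply filterlim_comp; [exact (Hf z Hz)|].
    apply (filterlim_opp (f z)).
  + intros z; apply (continuous_minus (taylor_err M p n));
      [apply continuous_taylor_err | apply continuous_taylor_poly].
  + intros z Hz; specialize (H z Hz); apply Rabs_le_between in H; lra.
- enough (f q <= taylor_err M p n q + taylor_poly f p n q) by lra.
  apply (le_on_closure lo hi f
    (fun z => taylor_err M p n z + taylor_poly f p n z)); try lra.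
  + exact Hf.
  + intros z; apply (continuous_plus (taylor_err M p n));
      [apply continuous_taylor_err | apply continuous_taylor_poly].
  + intros z Hz; specialize (H z Hz); apply Rabs_le_between in H; lra.
Qed.

(** * The truncation error on a nonuniform mesh *)

(** The first-order terms of the two expansions about [w] cancel, and each
remainder is at most [M * k ^ 2 / 2]. *)
Lemma second_difference_bound (lo hi M : R) (g : R -> R) (w k : R) :
  continuous_on (fun s => lo <= s <= hi) g ->
  (forall s, lo < s < hi -> forall m, (m <= 2)%nat -> ex_derive_n g m s) ->
  (forall s, lo < s < hi -> Rabs (Derive_n g 2 s) <= M) ->
  0 < k -> lo <= w - k -> w + k <= hi ->
  Rabs (g (w + k) - 2 * g w + g (w - k)) <= M * k ^ 2.
Proof.
intros Hg Hex HM Hk Hl Hh.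
assert (Hw : lo < w < hi) by lra.
pose proof (taylor_bound lo hi M 1 g w (w + k) Hg Hex HM Hw) as H1.
pose proof (taylor_bound lo hi M 1 g w (w - k) Hg Hex HM Hw) as H2.
unfold taylor_poly, taylor_err in H1, H2.
replace (w + k - w) with k in H1 by ring.
replace (w - k - w) with (- k) in H2 by ring.
rewrite Rabs_Ropp in H2; rewrite (Rabs_pos_eq k) in H1, H2 by lra.
simpl sum_f_R0 in H1, H2; simpl fact in H1, H2.
change (INR 1) with 1 in H1, H2; change (INR 2) with 2 in H1, H2.
change (Derive_n g 0 w) with (g w) in H1, H2.
specialize (H1 ltac:(lra)); specialize (H2 ltac:(lra)).
apply Rabs_le_between in H1; apply Rabs_le_between in H2.
apply Rabs_le; simpl pow in *; lra.
Qed.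

(** The formula is exact on quadratic polynomials.  Its error on the cubic term
is a multiple of the difference of the two steps, which isolates the only
first-order contribution; the fourth-order remainders contribute at most
[M4 / 12 * W ^ 2]. *)
Lemma fd2_error (lo hi M3 M4 W : R) (f : R -> R) (x : nat -> R) (i : nat) :
  continuous_on (fun z => lo <= z <= hi) f ->
  (forall z, lo < z < hi -> forall k, (k <= 4)%nat -> ex_derive_n f k z) ->
  (forall z, lo < z < hi -> Rabs (Derive_n f 3 z) <= M3) ->
  (forall z, lo < z < hi -> Rabs (Derive_n f 4 z) <= M4) ->
  (1 <= i)%nat -> lo <= x (i - 1)%nat -> x (S i) <= hi ->
  0 < step x (i - 1) <= W -> 0 < step x i <= W ->
  Rabs (Derive_n f 2 (x i) - fd2 x (fun k => f (x k)) i)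
    <= M3 / 3 * Rabs (step x i - step x (i - 1)) + M4 / 12 * W ^ 2.
Proof.
intros Hf Hex HM3 HM4 Hi Hl Hh.
unfold fd2, step; replace (S (i - 1)) with i by lia.
set (p := x i) in *; set (h1 := p - x (i - 1)%nat); set (h2 := x (S i) - p).
replace (x (i - 1)%nat) with (p - h1) in * by (unfold h1; ring).
replace (x (S i)) with (p + h2) in * by (unfold h2; ring).
clearbody h1 h2; clearbody p; intros [Hh1 HW1] [Hh2 HW2].
assert (Hp : lo < p < hi) by lra.
assert (Hq : forall d, lo <= p + d <= hi -> Rabs (f (p + d) - (f p
    + d * Derive_n f 1 p + d ^ 2 / 2 * Derive_n f 2 p
    + d ^ 3 / 6 * Derive_n f 3 p)) <= M4 * Rabs d ^ 4 / 24).
{ intros d Hd.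
  pose proof (taylor_bound lo hi M4 3 f p (p + d) Hf Hex HM4 Hp Hd) as H.
  unfold taylor_poly, taylor_err in H.
  replace (p + d - p) with d in H by ring.
  cbn [sum_f_R0] in H; cbn [fact Nat.add Nat.mul] in H.
  rewrite !INR_IZR_INZ in H; cbn [Z.of_nat Pos.of_succ_nat Pos.succ] in H.
  change (Derive_n f 0 p) with (f p) in H.
  replace (d ^ 0 / 1 * f p + d ^ 1 / 1 * Derive_n f 1 p) with
    (f p + d * Derive_n f 1 p) in H by field.
  exact H. }
pose proof (Hq (- h1) ltac:(lra)) as H1; pose proof (Hq h2 ltac:(lra)) as H2.
rewrite Rabs_Ropp, (Rabs_pos_eq h1) in H1 by lra; rewrite (Rabs_pos_eq h2) in H2 by lra.
change (p + - h1) with (p - h1) in H1.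
set (r1 := f (p - h1) - _) in H1; set (r2 := f (p + h2) - _) in H2.
pose proof (HM3 p Hp) as H3.
assert (HM4' : 0 <= M4) by (eapply Rle_trans; [apply Rabs_pos | exact (HM4 p Hp)]).
assert (Heq : Derive_n f 2 p
    - (2 * f (p - h1) / (h1 * (h1 + h2)) - 2 * f p / (h1 * h2)
       + 2 * f (p + h2) / (h2 * (h1 + h2)))
  = - (Derive_n f 3 p / 3 * (h2 - h1) + (r1 / h1 + r2 / h2) * (2 / (h1 + h2)))).
{ unfold r1, r2; field; repeat split; lra. }
rewrite Heq, Rabs_Ropp.
(* Of the four powers of the step in a remainder, one goes into the division by
   [h] and one is kept apart, so that the two bounds add up to a multiple of
   [h1 + h2], which the formula divides by. *)
assert (Hr : forall r h, 0 < h -> h <= W -> Rabs r <= M4 * h ^ 4 / 24 ->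
    Rabs (r / h) <= M4 / 24 * W ^ 2 * h).
{ intros r h Hh0 HhW Hr; unfold Rdiv at 1; rewrite Rabs_mult.
  rewrite (Rabs_pos_eq (/ h)) by (left; apply Rinv_0_lt_compat, Hh0).
  apply Rle_trans with (M4 * h ^ 4 / 24 * / h).
  - apply Rmult_le_compat_r; [left; apply Rinv_0_lt_compat, Hh0 | exact Hr].
  - replace (M4 * h ^ 4 / 24 * / h) with (M4 / 24 * h ^ 2 * h) by (field; lra).
    apply Rmult_le_compat_r; [lra|]; apply Rmult_le_compat_l; [lra|].
    apply pow_incr; lra. }
eapply Rle_trans; [apply Rabs_triang|]; apply Rplus_le_compat.
- rewrite Rabs_mult; apply Rmult_le_compat_r; [apply Rabs_pos|].
  unfold Rdiv; rewrite Rabs_mult, (Rabs_pos_eq (/ 3)) by lra; lra.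
- assert (Hpos : 0 < 2 / (h1 + h2)) by (apply Rdiv_lt_0_compat; lra).
  rewrite Rabs_mult, (Rabs_pos_eq (2 / _)) by lra.
  replace (M4 / 12 * W ^ 2)
    with (M4 / 24 * W ^ 2 * (h1 + h2) * (2 / (h1 + h2))) by (field; lra).
  apply Rmult_le_compat_r; [lra|].
  eapply Rle_trans; [apply Rabs_triang|].
  pose proof (Hr r1 h1 Hh1 HW1 H1); pose proof (Hr r2 h2 Hh2 HW2 H2); lra.
Qed.

(** * Smoothly mapped meshes *)

Lemma step_le_mesh_width (N : nat) (x : nat -> R) (i : nat) :
  (i <= N)%nat -> step x i <= mesh_width N x.
Proof.
intros Hi; unfold mesh_width.
assert (Hin : In i (seq 0 (S N))) by (apply in_seq; lia).
induction (seq 0 (S N)) as [|s l IH]; simpl in *; [contradiction|].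
destruct Hin as [-> | Hin]; [apply Rmax_l|].
eapply Rle_trans; [exact (IH Hin) | apply Rmax_r].
Qed.

(** The left-hand side is the average of the [N + 1] steps, whose sum telescopes
to 2, and an average is at most the maximum.  This converts estimates in the
parameter step into estimates in the mesh width. *)
Lemma uniform_step_le_mesh_width (N : nat) (x : nat -> R) :
  is_mesh N x -> 2 / INR (S N) <= mesh_width N x.
Proof.
intros [H0 [H1 _]].
assert (Htel : forall n, (n <= S N)%nat -> x n - x 0%nat <= INR n * mesh_width N x).
{ induction n as [|n IH]; intros Hn; [simpl; lra|].
  pose proof (step_le_mesh_width N x n ltac:(lia)) as Hs; unfold step in Hs.
  specialize (IH ltac:(lia)); rewrite S_INR; lra. }
specialize (Htel (S N) (le_n _)); rewrite H0, H1 in Htel.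
assert (HN : 0 < INR (S N)) by (apply lt_0_INR; lia).
apply Rmult_le_reg_r with (INR (S N)); [exact HN|].
unfold Rdiv; rewrite Rmult_assoc, Rinv_l by lra; lra.
Qed.

Lemma mesh_increasing (N : nat) (x : nat -> R) :
  is_mesh N x -> forall i j, (i < j)%nat -> (j <= S N)%nat -> x i < x j.
Proof.
intros [_ [_ Hs]] i j Hij; induction Hij as [|j Hij IH]; intros Hj.
- specialize (Hs i ltac:(lia)); unfold step in Hs; lra.
- specialize (Hs j ltac:(lia)); specialize (IH ltac:(lia)); unfold step in Hs; lra.
Qed.

Lemma mesh_bounds (N : nat) (x : nat -> R) (i : nat) :
  is_mesh N x -> (i <= S N)%nat -> -1 <= x i <= 1.
Proof.
intros Hm Hi; pose proof Hm as [H0 [H1 _]].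
pose proof (mesh_increasing N x Hm) as Hinc; rewrite <- H0 at 1; rewrite <- H1; split.
- destruct i; [lra | left; apply Hinc; lia].
- destruct (Nat.eq_dec i (S N)) as [-> | Hne]; [lra | left; apply Hinc; lia].
Qed.

Lemma mesh_interior (N : nat) (x : nat -> R) (i : nat) :
  is_mesh N x -> (1 <= i <= N)%nat -> -1 < x i < 1.
Proof.
intros Hm Hi; pose proof Hm as [H0 [H1 _]].
pose proof (mesh_increasing N x Hm) as Hinc.
rewrite <- H0 at 1; rewrite <- H1; split; apply Hinc; lia.
Qed.

(** The reason why smoothly mapped meshes gain an order: neighbouring steps are
equal up to a second difference of the mapping. *)
Lemma adjacent_step_difference (M : R) (g : R -> R) (N : nat) (x : nat -> R)
    (i : nat) :
  continuous_on (fun s => -1 <= s <= 1) g ->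
  (forall s, -1 < s < 1 -> forall m, (m <= 2)%nat -> ex_derive_n g m s) ->
  (forall s, -1 < s < 1 -> Rabs (Derive_n g 2 s) <= M) ->
  0 <= M -> is_mesh N x -> image_of_uniform g N x -> (1 <= i <= N)%nat ->
  Rabs (step x i - step x (i - 1)) <= M * mesh_width N x ^ 2.
Proof.
intros Hg Hex HM HM0 Hm Him Hi.
set (k := 2 / INR (S N)); set (w := uniform_node N i).
assert (HN : 0 < INR (S N)) by (apply lt_0_INR; lia).
assert (Hk : 0 < k) by (apply Rdiv_lt_0_compat; lra).
assert (HNk : INR (S N) * k = 2) by (unfold k; field; lra).
assert (Hi1 : 1 <= INR i) by (apply (le_INR 1); lia).
assert (HiN : INR i <= INR (S N) - 1) by (rewrite S_INR; pose proof (le_INR i N ltac:(lia)); lra).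
assert (Hw : w = -1 + INR i * k) by reflexivity.
replace (step x i - step x (i - 1)) with (g (w + k) - 2 * g w + g (w - k)).
- eapply Rle_trans.
  + apply (second_difference_bound (-1) 1 M g w k); try assumption; rewrite Hw; nra.
  + apply Rmult_le_compat_l; [exact HM0|]; apply pow_incr; split; [lra|].
    apply uniform_step_le_mesh_width, Hm.
- unfold step; replace (S (i - 1)) with i by lia.
  rewrite (Him (S i)), (Him i), (Him (i - 1)%nat) by lia.
  replace (uniform_node N (S i)) with (w + k).
  + replace (uniform_node N (i - 1)) with (w - k); [fold w; ring|].
    unfold uniform_node; rewrite minus_INR by lia; rewrite Hw; fold k; simpl INR; ring.
  + unfold uniform_node; rewrite S_INR, Hw; fold k; ring.
Qed.

Lemma fd2_second_order (g f : R -> R) (Mg M3 M4 : R) (N : nat) (x : nat -> R)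
    (i : nat) :
  continuous_on (fun s => -1 <= s <= 1) g ->
  (forall s, -1 < s < 1 -> forall m, (m <= 2)%nat -> ex_derive_n g m s) ->
  (forall s, -1 < s < 1 -> Rabs (Derive_n g 2 s) <= Mg) ->
  continuous_on (fun z => -1 <= z <= 1) f ->
  (forall z, -1 < z < 1 -> forall k, (k <= 4)%nat -> ex_derive_n f k z) ->
  (forall z, -1 < z < 1 -> Rabs (Derive_n f 3 z) <= M3) ->
  (forall z, -1 < z < 1 -> Rabs (Derive_n f 4 z) <= M4) ->
  is_mesh N x -> image_of_uniform g N x -> (1 <= i <= N)%nat ->
  Rabs (Derive_n f 2 (x i) - fd2 x (fun k => f (x k)) i)
    <= (M3 / 3 * Mg + M4 / 12) * mesh_width N x ^ 2.
Proof.
intros Hg Hgex HMg Hf Hfex HM3 HM4 Hm Him Hi.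
assert (Hnonneg : forall (h : R -> R) k M,
    (forall s, -1 < s < 1 -> Rabs (Derive_n h k s) <= M) -> 0 <= M).
{ intros h k M H; eapply Rle_trans; [apply Rabs_pos | apply (H 0); lra]. }
assert (Hstep : forall j, (j <= N)%nat -> 0 < step x j <= mesh_width N x).
{ intros j Hj; split; [apply Hm, Hj | apply step_le_mesh_width, Hj]. }
eapply Rle_trans.
- apply (fd2_error (-1) 1 M3 M4 (mesh_width N x)); try assumption; try lia.
  + apply (mesh_bounds N x); [exact Hm | lia].
  + apply (mesh_bounds N x); [exact Hm | lia].
  + apply Hstep; lia.
  + apply Hstep; lia.
- rewrite Rmult_plus_distr_r, (Rmult_assoc (M3 / 3)).
  apply Rplus_le_compat_r, Rmult_le_compat_l.
  + pose proof (Hnonneg f 3%nat M3 HM3); lra.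
  + exact (adjacent_step_difference Mg g N x i Hg Hgex HMg (Hnonneg g 2%nat Mg HMg)
             Hm Him Hi).
Qed.

Lemma smooth_mapping_Derive_n_bounded (g : R -> R) (k : nat) :
  smooth_mapping g ->
  exists M, forall s, -1 < s < 1 -> Rabs (Derive_n g k s) <= M.
Proof.
intros [_ Hg]; destruct (Hg k) as [_ [v [Hv Hvg]]].
destruct (continuous_on_segment_bounded (-1) 1 v Hv) as [M HM].
exists M; intros s Hs; rewrite <- Hvg by exact Hs; apply HM; lra.
Qed.

Lemma space_Cn_Derive_n_bounded (n k : nat) (t0 Tq t1 t2 : R)
    (u : R -> R -> R -> R) :
  space_Cn n t0 Tq u -> (k <= n)%nat -> t0 < t1 -> t2 < Tq ->
  exists M, forall x y t, open_square x y -> t1 <= t <= t2 ->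
    Rabs (Derive_n (fun z => u z y t) k x) <= M /\
    Rabs (Derive_n (fun z => u x z t) k y) <= M.
Proof.
intros Hu Hk Ht1 Ht2.
destruct (Hu k Hk) as [_ [[v [Hv Hvu]] [w [Hw Hwu]]]].
destruct (continuous3_on_box_bounded _ t1 t2 v Hv) as [Mv HMv].
{ intros x y t Hxy Ht; split; [exact Hxy | lra]. }
destruct (continuous3_on_box_bounded _ t1 t2 w Hw) as [Mw HMw].
{ intros x y t Hxy Ht; split; [exact Hxy | lra]. }
exists (Rmax Mv Mw); intros x y t Hxy Ht.
assert (Hcl : closed_square x y) by (unfold open_square, closed_square in *; lra).
rewrite <- Hvu, <- Hwu by (assumption || lra); split.
- eapply Rle_trans; [exact (HMv x y t Hcl Ht) | apply Rmax_l].
- eapply Rle_trans; [exact (HMw x y t Hcl Ht) | apply Rmax_r].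
Qed.

(** * Second order in both directions *)

Theorem lemma2p2
    (a b t0 Tq : R) (sigma eps : R -> R -> R) (f : R -> R -> R)
    (u0 : R -> R -> R) (u : R -> R -> R -> R) (gx gy : R -> R)
    (Hsol : is_solution a b t0 Tq sigma eps f u0 u)
    (Hreg : space_Cn 4 t0 Tq u)
    (Hgx : smooth_mapping gx) (Hgy : smooth_mapping gy) :
  forall t1 t2 : R, t0 < t1 -> t1 <= t2 -> t2 < Tq ->
  exists C : R,
  forall (Nx Ny : nat) (x y : nat -> R),
    is_mesh Nx x -> is_mesh Ny y ->
    image_of_uniform gx Nx x -> image_of_uniform gy Ny y ->
    forall (i j : nat) (t : R),
      (1 <= i <= Nx)%nat -> (1 <= j <= Ny)%nat -> t1 <= t <= t2 ->
      Rabs (Derive_n (fun z => u z (y j) t) 2 (x i)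
            - fd2 x (fun k => u (x k) (y j) t) i)
        <= C * mesh_width Nx x ^ 2 /\
      Rabs (Derive_n (fun z => u (x i) z t) 2 (y j)
            - fd2 y (fun k => u (x i) (y k) t) j)
        <= C * mesh_width Ny y ^ 2.
Proof.
intros t1 t2 Ht01 Ht12 Ht2q.
destruct (smooth_mapping_Derive_n_bounded gx 2 Hgx) as [Mx HMx].
destruct (smooth_mapping_Derive_n_bounded gy 2 Hgy) as [My HMy].
destruct (space_Cn_Derive_n_bounded 4 3 t0 Tq t1 t2 u Hreg) as [M3 HM3];
  try lra; try lia.
destruct (space_Cn_Derive_n_bounded 4 4 t0 Tq t1 t2 u Hreg) as [M4 HM4];
  try lra; try lia.
exists (Rmax (M3 / 3 * Mx + M4 / 12) (M3 / 3 * My + M4 / 12)).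
intros Nx Ny x y Hmx Hmy Himx Himy i j t Hi Hj Ht.
pose proof (mesh_interior Nx x i Hmx Hi) as Hxi.
pose proof (mesh_interior Ny y j Hmy Hj) as Hyj.
pose proof (sol_cont _ _ _ _ _ _ _ _ _ Hsol) as Hcont.
split.
- eapply Rle_trans;
    [| apply Rmult_le_compat_r; [apply pow2_ge_0 | apply Rmax_l]].
  apply (fd2_second_order gx (fun z => u z (y j) t)); try assumption.
  + apply Hgx.
  + intros s Hs m _; apply (proj2 Hgx m), Hs.
  + apply (continuous_on_sub (fun z => closed_square z (y j) /\ t0 <= t < Tq)).
    * intros z Hz; unfold closed_square; lra.
    * exact (continuous3_on_slice_x _ u (y j) t Hcont).
  + intros z Hz k Hk; apply (Hreg k Hk); [split; assumption | lra].
  + intros z Hz; apply (HM3 z (y j) t); [split; assumption | exact Ht].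
  + intros z Hz; apply (HM4 z (y j) t); [split; assumption | exact Ht].
- eapply Rle_trans;
    [| apply Rmult_le_compat_r; [apply pow2_ge_0 | apply Rmax_r]].
  apply (fd2_second_order gy (fun z => u (x i) z t)); try assumption.
  + apply Hgy.
  + intros s Hs m _; apply (proj2 Hgy m), Hs.
  + apply (continuous_on_sub (fun z => closed_square (x i) z /\ t0 <= t < Tq)).
    * intros z Hz; unfold closed_square; lra.
    * exact (continuous3_on_slice_y _ u (x i) t Hcont).
  + intros z Hz k Hk; apply (Hreg k Hk); [split; assumption | lra].
  + intros z Hz; apply (HM3 (x i) z t); [split; assumption | exact Ht].
  + intros z Hz; apply (HM4 (x i) z t); [split; assumption | exact Ht].
Qed.
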